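(* The mapping $\Lambda \colon \mathbf{Ring} \to \mathbf{Graph}$ that maps a ring $R$ to its compressed commuting graph $\Lambda(R)$, and a ring morphism $f \colon R \to S$ to the graph morphism $\Lambda(f) \colon \Lambda(R) \to \Lambda(S)$ given by $\Lambda(f)([r]) = [f(r)]$, is a (well defined) functor.
   Context: Rings are associative and possibly nonunital. For a ring $R$ and $a \in R$, let $\langle a \rangle = \{q(a) \mid q \in \mathbb{Z}[x],\ q(0)=0\}$ be the subring of $R$ generated by $a$. Define an equivalence relation on $R$ by $a \sim b$ if and only if $\langle a \rangle = \langle b \rangle$, and let $[a]$ be the equivalence class of $a$. The compressed commuting graph $\Lambda(R)$ is the undirected graph whose vertex set is the set of all equivalence classes of elements of $R$ with respect to $\sim$, with an edge between $[a]$ and $[b]$ if and only if $ab=ba$ (loops are allowed; in fact every vertex has a loop; central elements are not excluded). $\mathbf{Ring}$ is the category of all (possibly nonunital) rings and ring homomorphisms. $\mathbf{Graph}$ is the category of undirected simple graphs that allow loops, with graph homomorphisms (maps of vertices sending adjacent vertices to adjacent vertices) as morphisms. *)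

(* Defs.v *)
From HB Require Import structures.
From mathcomp Require Import all_boot all_algebra.
From mathcomp Require Import boolp classical_sets.

Set Implicit Arguments.
Unset Strict Implicit.
Unset Printing Implicit Defensive.

Import GRing.Theory.
Local Open Scope ring_scope.
Local Open Scope quotient_scope.
Local Open Scope classical_set_scope.

(* Associative, possibly nonunital (and possibly zero) rings.  The product is
   the semigroup product, written [(a * b)%g]; the library's ring structures
   all have a unit. *)
HB.mixin Record Zmodule_Semigroup_isRng R of GRing.Zmodule R & Semigroup R := {
  rng_mulDl : left_distributive ( *%g : R -> R -> R) +%R;
  rng_mulDr : right_distributive ( *%g : R -> R -> R) +%R
}.

#[short(type="rngType")]
HB.structure Definition Rng :=
  {R of Zmodule_Semigroup_isRng R & GRing.Zmodule R & Semigroup R}.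

#[short(type="rngMorphism")]
HB.structure Definition RngMorphism (R S : rngType) :=
  {f of @GRing.Additive R S f & @Multiplicative R S f}.

Lemma rngMorphism_ext (R S : rngType) (f g : rngMorphism R S) :
  f =1 g -> f = g.
Proof.
case: f g => [f fP] [g gP] /= /funext fg; subst g; congr RngMorphism.Pack.
case: fP gP => [[fA] [fM]] [[gA] [gM]].
by rewrite (Prop_irrelevance fA gA) (Prop_irrelevance fM gM).
Qed.

HB.instance Definition _ (R : rngType) := Multiplicative.on (@idfun R).

HB.instance Definition _ (R S T : rngType) (g : rngMorphism S T)
  (f : rngMorphism R S) := Multiplicative.on (g \o f).

(* Undirected graphs without multiple edges, loops being allowed. *)
Record graph := Graph {
  vertex :> Type;
  adj : vertex -> vertex -> Prop;
  adj_sym : forall x y, adj x y -> adj y x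
}.

Record graphMorphism (G H : graph) := GraphMorphism {
  graph_fun :> G -> H;
  graph_fun_adj : forall x y, adj x y -> adj (graph_fun x) (graph_fun y)
}.

Lemma graphMorphism_ext (G H : graph) (f g : graphMorphism G H) :
  f =1 g -> f = g.
Proof.
case: f => f fP; case: g => g gP /= /funext fg.
by subst g; rewrite (Prop_irrelevance gP fP).
Qed.

Definition graph_id (G : graph) : graphMorphism G G :=
  @GraphMorphism G G idfun (fun _ _ => id).

Definition graph_comp (G H K : graph) (g : graphMorphism H K)
    (f : graphMorphism G H) : graphMorphism G K :=
  @GraphMorphism G K (g \o f)
    (fun x y xy => graph_fun_adj g (graph_fun_adj f xy)).

Record category := Category {
  obj :> Type;
  hom : obj -> obj -> Type;
  idm : forall X, hom X X;
  compm : forall X Y Z, hom Y Z -> hom X Y -> hom X Z;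
  compm_idl : forall X Y (f : hom X Y), compm (idm Y) f = f;
  compm_idr : forall X Y (f : hom X Y), compm f (idm X) = f;
  compmA : forall X Y Z W (h : hom Z W) (g : hom Y Z) (f : hom X Y),
    compm h (compm g f) = compm (compm h g) f
}.

Definition is_functor (C D : category) (Fobj : C -> D)
    (Fhom : forall X Y : C, hom X Y -> hom (Fobj X) (Fobj Y)) : Prop :=
  (forall X : C, Fhom X X (idm X) = idm (Fobj X)) /\
  (forall (X Y Z : C) (g : hom Y Z) (f : hom X Y),
     Fhom X Z (compm g f) = compm (Fhom Y Z g) (Fhom X Y f)).

Definition RingCat : category.
Proof.
refine (@Category rngType rngMorphism
  (fun R => (@idfun R : rngMorphism R R))
  (fun R S T (g : rngMorphism S T) (f : rngMorphism R S) =>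
     (g \o f : rngMorphism R T)) _ _ _);
  by move=> *; apply: rngMorphism_ext.
Defined.

Definition GraphCat : category.
Proof.
refine (@Category graph graphMorphism graph_id graph_comp _ _ _);
  by move=> *; apply: graphMorphism_ext.
Defined.

(* [rng_exp a n] is a ^ n for n >= 1; its value at n = 0 is irrelevant. *)
Definition rng_exp (R : rngType) (a : R) (n : nat) : R := iterop n ( *%g : R -> R -> R) a 0.

(* Evaluation at [a] of an integer polynomial without constant term: a
   constant term would have no meaning in [R], so the sum starts at 1. *)
Definition rng_eval (R : rngType) (q : {poly int}) (a : R) : R :=
  \sum_(1 <= i < size q) rng_exp a i *~ q`_i.

Definition subring_gen (R : rngType) (a : R) : set R :=
  [set rng_eval q a | q in [set q : {poly int} | q.[0] = 0]].

Definition gen_equiv (R : rngType) (a b : R) : bool :=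
  `[< subring_gen a = subring_gen b >].

Lemma gen_equiv_refl (R : rngType) : reflexive (@gen_equiv R).
Proof. by move=> a; apply/asboolP. Qed.

Lemma gen_equiv_sym (R : rngType) : symmetric (@gen_equiv R).
Proof. by move=> a b; apply/asboolP/asboolP. Qed.

Lemma gen_equiv_trans (R : rngType) : transitive (@gen_equiv R).
Proof. by move=> b a c /asboolP ab /asboolP bc; apply/asboolP; rewrite ab. Qed.

Canonical gen_equiv_equiv (R : rngType) :=
  EquivRel (@gen_equiv R) (@gen_equiv_refl R) (@gen_equiv_sym R)
    (@gen_equiv_trans R).

Definition gen_class (R : rngType) : Type := {eq_quot (@gen_equiv R)}.

Definition class_of (R : rngType) (a : R) : gen_class R :=
  \pi_{eq_quot (@gen_equiv R)} a.

(* Two classes are joined when they have commuting representatives; that any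
   two representatives then commute is not built into the definition. *)
Definition class_adj (R : rngType) (x y : gen_class R) : Prop :=
  exists a b : R, [/\ x = class_of a, y = class_of b & (a * b = b * a)%g].

Lemma class_adj_sym (R : rngType) (x y : gen_class R) :
  class_adj x y -> class_adj y x.
Proof. by case=> a [b [-> -> ab]]; exists b, a. Qed.

Definition Lambda (R : rngType) : graph :=
  @Graph (gen_class R) (@class_adj R) (@class_adj_sym R).

(* Main.v *)
(* Since a = q(a) for q = x, two generators of the same subring are integer
   polynomials in one another, so whatever commutes with one commutes with the
   other.  Ring morphisms commute with the evaluation of integer polynomials
   without constant term, so the image of <a> under f is <f(a)>; hence
   <a> = <b> implies <f(a)> = <f(b)>. *)
Require Import Defs.
From HB Require Import structures.
From mathcomp Require Import all_boot all_algebra.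
From mathcomp Require Import boolp classical_sets.

Set Implicit Arguments.
Unset Strict Implicit.
Unset Printing Implicit Defensive.

Import GRing.Theory.
Local Open Scope ring_scope.
Local Open Scope classical_set_scope.

(** Commuting with [b] is recast as lying in the kernel of an additive map, so that the generic
    lemmas on sums and integer multiples apply to it. *)
Definition rng_commutator (R : rngType) (b c : R) : R := (b * c)%g - (c * b)%g.

Lemma rng_commutator_is_zmod_morphism (R : rngType) (b : R) :
  zmod_morphism (rng_commutator b).
Proof.
have mull0 (c : R) : (c * 0)%g = 0 :> R.
  by apply: (addrI (c * 0)%g); rewrite -rng_mulDr !addr0.
have mul0r (c : R) : (0 * c)%g = 0 :> R.
  by apply: (addrI (0 * c)%g); rewrite -rng_mulDl !addr0.
have mulrN (c d : R) : (c * - d)%g = - (c * d)%g :> R.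
  by apply: (addrI (c * d)%g); rewrite -rng_mulDr !subrr mull0.
have mulNr (c d : R) : (- c * d)%g = - (c * d)%g :> R.
  by apply: (addrI (c * d)%g); rewrite -rng_mulDl !subrr mul0r.
move=> x y; rewrite /rng_commutator rng_mulDr rng_mulDl mulrN mulNr.
by rewrite !opprD !opprK addrACA.
Qed.

HB.instance Definition _ (R : rngType) (b : R) :=
  GRing.isZmodMorphism.Build R R (rng_commutator b)
    (rng_commutator_is_zmod_morphism b).

Lemma rng_commutator_eq0 (R : rngType) (b c : R) :
  rng_commutator b c = 0 <-> (b * c = c * b)%g.
Proof. by split=> [/subr0_eq // | bc]; rewrite /rng_commutator bc subrr. Qed.

Lemma rng_exp_commute (R : rngType) (b a : R) n :
  (b * a = a * b)%g -> (b * rng_exp a n.+1 = rng_exp a n.+1 * b)%g.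
Proof.
move=> ba; rewrite /rng_exp iteropS.
by elim: n => //= n IHn; rewrite mulgA ba -mulgA IHn mulgA.
Qed.

Lemma rng_eval_commute (R : rngType) (b a : R) q :
  (b * a = a * b)%g -> (b * rng_eval q a = rng_eval q a * b)%g.
Proof.
move=> ba; apply/rng_commutator_eq0; rewrite raddf_sum big_nat.
(* The sum starts at 1, so index 0 is excluded and every exponent has the form [i.+1] that
   [rng_exp_commute] expects. *)
apply: big1 => -[//|i] _; rewrite raddfMz /=.
have /rng_commutator_eq0 -> := rng_exp_commute i ba.
exact: mul0rz.
Qed.

Lemma subring_gen_id (R : rngType) (a : R) : subring_gen a a.
Proof.
exists 'X; rewrite /= ?hornerX //.
by rewrite /rng_eval size_polyX big_nat1 coefX.
Qed.

Lemma class_ofP (R : rngType) (a b : R) :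
  class_of a = class_of b <-> subring_gen a = subring_gen b.
Proof.
split=> [/eqquotP /asboolP // | ab].
by apply/eqquotP; apply/asboolP.
Qed.

Lemma class_of_repr (R : rngType) (x : gen_class R) : class_of (repr x) = x.
Proof. exact: reprK. Qed.

Lemma class_of_commute (R : rngType) (a b c : R) :
  class_of a = class_of b -> (c * a = a * c)%g -> (c * b = b * c)%g.
Proof.
move=> /class_ofP ab ca.
have [q _ <-] : subring_gen a b by rewrite ab; apply: subring_gen_id.
exact: rng_eval_commute.
Qed.

Lemma class_of_adj (R : rngType) (a b : R) :
  class_adj (class_of a) (class_of b) <-> (a * b = b * a)%g.
Proof.
split=> [[c [d [ac bd cd]]]|ab]; last by exists a, b.
(* Representatives are exchanged one at a time: [c] and [d] commute, hence [a] and [d], hence [a]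
   and [b]. *)
apply: (class_of_commute (esym bd)); apply/esym.
by apply: (class_of_commute (esym ac)).
Qed.

Lemma rngMorph_exp (R S : rngType) (f : rngMorphism R S) (a : R) n :
  f (rng_exp a n) = rng_exp (f a) n.
Proof.
(* At exponent 0 the default value of [rng_exp] is 0, which [f] preserves. *)
case: n => [|n]; first exact: raddf0.
by rewrite /rng_exp !iteropS; elim: n => //= n IHn; rewrite gmulfM -IHn.
Qed.

Lemma rngMorph_eval (R S : rngType) (f : rngMorphism R S) q (a : R) :
  f (rng_eval q a) = rng_eval q (f a).
Proof.
rewrite /rng_eval raddf_sum; apply: eq_bigr => i _.
by rewrite raddfMz -rngMorph_exp.
Qed.

(** Both sides are images of the same set of polynomials, under maps that agree pointwise by
    [rngMorph_eval]. *)
Lemma image_subring_gen (R S : rngType) (f : rngMorphism R S) (a : R) :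
  f @` subring_gen a = subring_gen (f a).
Proof.
rewrite /subring_gen image_comp; apply: eq_imagel => q _.
exact: rngMorph_eval.
Qed.

Lemma class_of_rngMorph (R S : rngType) (f : rngMorphism R S) (a b : R) :
  class_of a = class_of b -> class_of (f a) = class_of (f b).
Proof.
by move=> /class_ofP ab; apply/class_ofP; rewrite -!image_subring_gen ab.
Qed.

(** The chosen representative [repr x] is arbitrary; [class_of_rngMorph] makes the value independent
    of it. *)
Definition Lambda_fun (R S : rngType) (f : rngMorphism R S) (x : Lambda R) :
  Lambda S := class_of (f (repr x)).

Lemma Lambda_fun_class_of (R S : rngType) (f : rngMorphism R S) (r : R) :
  Lambda_fun f (class_of r) = class_of (f r).
Proof. by apply: class_of_rngMorph; apply: class_of_repr. Qed.

Lemma Lambda_fun_adj (R S : rngType) (f : rngMorphism R S) (x y : Lambda R) :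
  adj x y -> adj (Lambda_fun f x) (Lambda_fun f y).
Proof.
case=> a [b [-> -> ab]]; rewrite !Lambda_fun_class_of.
by apply/class_of_adj; rewrite -gmulfM ab gmulfM.
Qed.

Definition Lambda_mor (R S : rngType) (f : rngMorphism R S) :
    graphMorphism (Lambda R) (Lambda S) :=
  GraphMorphism (@Lambda_fun_adj R S f).

(** Every vertex is the class of its representative. This reduces both the functor laws and
    uniqueness to the formula on classes. *)
Lemma Lambda_morphism_ext (R : rngType) (G : graph)
    (g h : graphMorphism (Lambda R) G) :
  (forall r : R, g (class_of r) = h (class_of r)) -> g = h.
Proof.
by move=> gh; apply: graphMorphism_ext => x; rewrite -(class_of_repr x) gh.
Qed.

Lemma Lambda_mor_functor : @is_functor RingCat GraphCat Lambda Lambda_mor.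
Proof.
split=> [R | R S T g f]; apply: Lambda_morphism_ext => r /=.
  exact: Lambda_fun_class_of.
by rewrite !Lambda_fun_class_of.
Qed.

(** The first conjunct shows that adjacency does not depend on representatives. Well-definedness of
    the rule sending [[r]] to [[f(r)]] is expressed as existence and uniqueness of a family of graph
    morphisms obeying it. *)
Theorem proposition3 :
  (forall (R : rngType) (a b : R),
     @adj (Lambda R) (class_of a) (class_of b) <-> (a * b = b * a)%g) /\
  exists Lambda_hom : forall R S : rngType,
      rngMorphism R S -> graphMorphism (Lambda R) (Lambda S),
    unique (fun L : forall R S : rngType,
                rngMorphism R S -> graphMorphism (Lambda R) (Lambda S) =>
              forall (R S : rngType) (f : rngMorphism R S) (r : R),
                L R S f (class_of r) = class_of (f r)) Lambda_hom /\
    @is_functor RingCat GraphCat Lambda Lambda_hom.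
Proof.
split; first exact: class_of_adj.
exists Lambda_mor; split; last exact: Lambda_mor_functor.
split=> [|L L_class]; first exact: Lambda_fun_class_of.
apply: functional_extensionality_dep => R.
apply: functional_extensionality_dep => S; apply/funext => f.
by apply: Lambda_morphism_ext => r; rewrite L_class /= Lambda_fun_class_of.
Qed.
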